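(* The Bohl spectrum $\Sigma_{\mathrm{B}}(A)$ of the system $x(n+1)=A(n)x(n)$, $n\in\mathbb{N}$, is the nonempty disjoint union of at most $d$ bounded intervals $$\Sigma_{\mathrm{B}}(A)=I_1\cup\dots\cup I_\ell,$$ where $\ell\in\{1,\dots,d\}$, and $\sup I_i\le\inf I_{i+1}$ and $[\sup I_i,\inf I_{i+1}]\cap\varrho_{\mathrm{B}}(A)\neq\emptyset$ for $i\in\{1,\dots,\ell-1\}$. Moreover, setting $I_0=I_{\ell+1}:=\emptyset$, $\inf\emptyset:=+\infty$ and $\sup\emptyset:=-\infty$, there exists a corresponding filtration $$\{0\}=V_0\subsetneq V_1\subsetneq\cdots\subsetneq V_\ell=\mathbb{R}^d$$ of linear subspaces, defined for $i\in\{0,\dots,\ell\}$ and $\gamma\in[\sup I_i,\inf I_{i+1}]\cap\varrho_{\mathrm{B}}(A)$ by $$V_i:=\{x_0\in\mathbb{R}^d\setminus\{0\}:\overline{\beta}_A(x_0)<\gamma\}\cup\{0\}.$$ The definition of $V_i$ does not depend on the choice of $\gamma\in[\sup I_i,\inf I_{i+1}]\cap\varrho_{\mathrm{B}}(A)$.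
   Context: Here $\mathbb{N}=\{0,1,2,\dots\}$, $d\ge 1$, and $A=(A(n))_{n\in\mathbb{N}}$ is a Lyapunov sequence: each $A(n)\in\mathbb{R}^{d\times d}$ is invertible and both $(A(n))_{n\in\mathbb{N}}$ and $(A(n)^{-1})_{n\in\mathbb{N}}$ are bounded. For $x_0\in\mathbb{R}^d$, $x(\cdot,x_0)$ denotes the solution of $x(n+1)=A(n)x(n)$ with $x(0,x_0)=x_0$. For $x_0\neq 0$ the upper and lower Bohl exponents are $$\overline{\beta}_A(x_0)=\inf_{N\in\mathbb{N}}\ \sup_{n,m\in\mathbb{N},\,n-m>N}\frac{1}{n-m}\ln\frac{\|x(n,x_0)\|}{\|x(m,x_0)\|},\qquad \underline{\beta}_A(x_0)=\sup_{N\in\mathbb{N}}\ \inf_{n,m\in\mathbb{N},\,n-m>N}\frac{1}{n-m}\ln\frac{\|x(n,x_0)\|}{\|x(m,x_0)\|}.$$ The Bohl spectrum is $\Sigma_{\mathrm{B}}(A)=\bigcup_{x_0\in\mathbb{R}^d\setminus\{0\}}[\underline{\beta}_A(x_0),\overline{\beta}_A(x_0)]$ and its resolvent is $\varrho_{\mathrm{B}}(A)=\mathbb{R}\setminus\Sigma_{\mathrm{B}}(A)$. Intervals $[a,b]$ with possibly infinite endpoints are understood in the extended real line. *)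

(* Defs.v *)
From HB Require Import structures.
From mathcomp Require Export all_boot all_order all_algebra.
From mathcomp Require Export all_classical all_reals all_analysis.
Export Order.TTheory GRing.Theory Num.Theory.
Export numFieldNormedType.Exports.

Set Implicit Arguments.
Unset Strict Implicit.
Unset Printing Implicit Defensive.

Local Open Scope classical_set_scope.
Local Open Scope ring_scope.

(* Norms are an explicit parameter so that the result covers every norm on
   R^d, not only the max-norm `|_| that the library puts on matrices.
   Nonnegativity follows from the three clauses. *)
Definition is_norm (R : realType) (d : nat) (nrm : 'cV[R]_d -> R) : Prop :=
  [/\ forall x y, nrm (x + y) <= nrm x + nrm y,
      forall (a : R) x, nrm (a *: x) = `|a| * nrm x
    & forall x, nrm x = 0 -> x = 0].

Definition lyapunov_sequence (R : realType) (d : nat) (A : nat -> 'M[R]_d) : Prop :=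
  [/\ forall n, A n \in unitmx,
      bounded_fun A
    & bounded_fun (fun n => invmx (A n))].

Fixpoint solution (R : realType) (d : nat) (A : nat -> 'M[R]_d)
    (x0 : 'cV[R]_d) (n : nat) : 'cV[R]_d :=
  if n is k.+1 then A k *m solution A x0 k else x0.

Section Bohl.
Context (R : realType) (d : nat) (nrm : 'cV[R]_d -> R) (A : nat -> 'M[R]_d).

(* Values of the quotient for the pairs (n, m) with n - m > N; the truncated
   subtraction on nat is harmless, since N < n - m forces m < n. *)
Definition bohl_quotients (x0 : 'cV[R]_d) (N : nat) : set (\bar R) :=
  [set (1 / (p.1 - p.2)%N%:R
        * ln (nrm (solution A x0 p.1) / nrm (solution A x0 p.2)))%:E
    | p in [set p : nat * nat | (N < p.1 - p.2)%N]].

Definition upper_bohl (x0 : 'cV[R]_d) : \bar R :=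
  ereal_inf [set ereal_sup (bohl_quotients x0 N) | N in [set: nat]].

Definition lower_bohl (x0 : 'cV[R]_d) : \bar R :=
  ereal_sup [set ereal_inf (bohl_quotients x0 N) | N in [set: nat]].

(* A set of extended reals, so that equating it with a union of sets of reals
   also says that it contains neither -oo nor +oo. *)
Definition bohl_spectrum : set (\bar R) :=
  \bigcup_(x0 in [set x : 'cV[R]_d | x != 0])
    [set e : \bar R | (lower_bohl x0 <= e <= upper_bohl x0)%E].

Definition bohl_resolvent : set R := [set r | ~ bohl_spectrum r%:E].

Definition bohl_sublevel (gamma : R) : set 'cV[R]_d :=
  [set x0 | x0 != 0 /\ (upper_bohl x0 < gamma%:E)%E] `|` [set 0].

End Bohl.

(* The real points of [sup I, inf J]; ereal_sup set0 = -oo and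
   ereal_inf set0 = +oo provide the conventions for the empty set. *)
Definition gap (R : realType) (I J : set R) : set R :=
  [set gamma | (ereal_sup (EFin @` I) <= gamma%:E <= ereal_inf (EFin @` J))%E].

(* Main.v *)
Require Import Defs.
From mathcomp Require Import lra.

(* If gamma is in the resolvent, every nonzero x0 has upper exponent < gamma or
   lower exponent > gamma, i.e. its solution grows strictly slower or strictly
   faster than exp(gamma n).  Hence the sublevel V_gamma is a subspace, although
   Bohl exponents do not obey the ultrametric inequality: a sum of two slow
   solutions cannot be fast.  For resolvent points gamma < gamma', V_gamma is a
   proper subspace of V_gamma' exactly when a spectral point separates them.
   So the intervals of the spectrum are the gaps between the level sets of
   dim V_gamma, which takes at most d + 1 values, among them 0 and d because
   one-step growth factors are bounded. *)

Set Implicit Arguments.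
Unset Strict Implicit.
Unset Printing Implicit Defensive.

Local Open Scope classical_set_scope.
Local Open Scope ring_scope.

(** * Estimates for the max-norm of matrices *)

Section MatrixNorm.
Context (R : realType).

Lemma normr_mxE_le (m n : nat) (M : 'M[R]_(m, n)) i j : `|M i j| <= `|M|.
Proof.
rewrite [leRHS]/Num.norm /= mx_normrE.
exact: (@le_bigmax _ _ _ 0 (fun ij : 'I_m * 'I_n => `|M ij.1 ij.2|) (i, j)).
Qed.

Lemma normr_mx_le (m n : nat) (M : 'M[R]_(m, n)) a :
  0 <= a -> (forall i j, `|M i j| <= a) -> `|M| <= a.
Proof.
move=> a_ge0 Ma; rewrite [leLHS]/Num.norm /= mx_normrE.
by apply: bigmax_le => // -[i j] _; exact: Ma.
Qed.

(** Each entry of the product is a sum of [n] products of entries, whence the factor [n]. *)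
Lemma normr_mulmx_le (m n p : nat) (M : 'M[R]_(m, n)) (N : 'M[R]_(n, p)) :
  `|M *m N| <= n%:R * `|M| * `|N|.
Proof.
apply: normr_mx_le => [|i j]; first by rewrite !mulr_ge0.
rewrite mxE (le_trans (ler_norm_sum _ _ _))//.
have -> : n%:R * `|M| * `|N| = \sum_(k < n) `|M| * `|N|.
  by rewrite sumr_const card_ord -mulrA mulr_natl.
by apply: ler_sum => k _; rewrite normrM ler_pM// normr_mxE_le.
Qed.

Lemma normr_trmx (m n : nat) (M : 'M[R]_(m, n)) : `|M^T| = `|M|.
Proof.
apply/eqP; rewrite eq_le; apply/andP; split; apply: normr_mx_le => // i j.
  by rewrite mxE normr_mxE_le.
by rewrite -[M i j](mxE trmx_key (fun a b => M b a)) normr_mxE_le.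
Qed.

End MatrixNorm.

(** * Equivalence of an arbitrary norm with the max-norm *)

Section NormEquivalence.
Context (R : realType) (d : nat) (nrm : 'cV[R]_d -> R).
Hypothesis nrm_norm : is_norm nrm.

Lemma is_norm0 : nrm 0 = 0.
Proof. by case: nrm_norm => _ nZ _; rewrite -(scale0r 0) nZ normr0 mul0r. Qed.

Lemma is_normN x : nrm (- x) = nrm x.
Proof.
by case: nrm_norm => _ nZ _; rewrite -scaleN1r nZ normrN normr1 mul1r.
Qed.

Lemma is_norm_ge0 x : 0 <= nrm x.
Proof.
case: nrm_norm => nD _ _; have := nD x (- x).
by rewrite subrr is_norm0 is_normN -mulr2n pmulrn_lge0.
Qed.

Lemma is_norm_gt0 x : x != 0 -> 0 < nrm x.
Proof.
case: nrm_norm => _ _ n0 x0; rewrite lt_neqAle is_norm_ge0 andbT eq_sym.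
by apply: contra_neq x0; exact: n0.
Qed.

Lemma is_norm_sum (I : finType) (F : I -> 'cV[R]_d) :
  nrm (\sum_i F i) <= \sum_i nrm (F i).
Proof.
case: nrm_norm => nD _ _.
elim/big_ind2: _ => [|x a y b xa yb|//]; first by rewrite is_norm0.
by rewrite (le_trans (nD _ _))// lerD.
Qed.

Lemma is_norm_le_normr : exists2 C, 0 <= C & forall x, nrm x <= C * `|x|.
Proof.
exists (\sum_(i < d) nrm (delta_mx i 0)) => [|x].
  by apply: sumr_ge0 => i _; exact: is_norm_ge0.
rewrite [x in leLHS]matrix_sum_delta (le_trans (is_norm_sum _))// mulr_suml.
apply: ler_sum => i _; case: nrm_norm => _ nZ _.
by rewrite big_ord1 nZ mulrC ler_wpM2l ?is_norm_ge0// normr_mxE_le.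
Qed.

Lemma is_norm_lipschitz C :
  (forall x, nrm x <= C * `|x|) -> forall x y, `|nrm x - nrm y| <= C * `|x - y|.
Proof.
move=> nC x y; case: nrm_norm => nD _ _.
have := nD (x - y) y; have := nD (y - x) x; rewrite !subrK.
have := nC (x - y); have := nC (y - x); rewrite -(distrC x y) ler_norml.
by move=> *; apply/andP; split; lra.
Qed.

(** The norm is continuous and attains a positive minimum on the compact max-norm unit sphere; the
    inverse of that minimum is the constant. Transposing to row vectors fits [EVT_min_rV]. *)
Lemma normr_le_is_norm : exists2 c, 0 <= c & forall x, `|x| <= c * nrm x.
Proof.
have [C C0 nC] := is_norm_le_normr.
pose f (v : 'rV[R]_d) := nrm v^T.
pose S := [set v : 'rV[R]_d | `|v| = 1].
(* If the sphere is empty, every vector is zero and the constant 0 works. *)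
have [S0|/set0P/negP/negPn/eqP S0] := pselect (S !=set0); last first.
  exists 0 => // x; rewrite mul0r normr_le0; apply: contrapT => /negP x0.
  suff : S (`|x|^-1 *: x^T) by rewrite S0.
  rewrite /S /= normrZ normr_trmx normfV normr_id mulVf//.
  by rewrite normr_eq0.
have cS : compact S.
  apply: bounded_closed_compact.
    by exists 1; split => // M M1 v /= ->; exact: ltW.
  rewrite (_ : S = Num.norm @^-1` [set 1])//.
  apply: closed_comp; last exact: closed_eq.
  by move=> v _; exact: norm_continuous.
have cf : continuous f.
  move=> v; apply/(@cvgrPdist_le _ _ _ (nbhs v) (nbhs_filter v)) => e e0.
  (* [C] may vanish, so [C + 1] is inverted instead. *)
  apply/nbhs_ballP; exists ((C + 1)^-1 * e) => [|w].
    by rewrite /= mulr_gt0// invr_gt0 ltr_wpDl.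
  rewrite -ball_normE /= => vw.
  apply: (le_trans (is_norm_lipschitz nC _ _)).
  rewrite -linearB /= normr_trmx.
  apply: (@le_trans _ _ ((C + 1) * `|v - w|)); first by rewrite ler_wpM2r// lerDl.
  by rewrite -ler_pdivlMl ?ltr_wpDl// ltW.
have [v0 Sv0 minv0] := EVT_min_rV S0 cS (continuous_subspaceT cf).
move: Sv0; rewrite inE /S/= => Sv0.
have fv0 : 0 < f v0.
  apply: is_norm_gt0; apply/eqP => /(congr1 trmx); rewrite trmxK trmx0 => v00.
  by move: Sv0; rewrite v00 normr0 => /esym/eqP; rewrite oner_eq0.
exists (f v0)^-1 => [|x]; first by rewrite invr_ge0 ltW.
have [->|x0] := eqVneq x 0; first by rewrite normr0 is_norm0 mulr0.
have nx0 : 0 < `|x| by rewrite normr_gt0.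
have := minv0 (`|x|^-1 *: x^T).
rewrite inE /S/= normrZ normr_trmx normfV normr_id mulVf ?gt_eqF// => /(_ erefl).
case: nrm_norm => _ nZ _.
rewrite /f linearZ /= trmxK nZ normfV normr_id => le_f.
rewrite ler_pdivlMl// -ler_pdivlMr//; first by rewrite mulrC.
Qed.

Lemma is_norm_mulmx_le : exists2 C, 0 <= C &
  forall (M : 'M[R]_d) x, nrm (M *m x) <= C * `|M| * nrm x.
Proof.
have [C C0 nC] := is_norm_le_normr; have [c c0 cn] := normr_le_is_norm.
exists (C * (d%:R * c)) => [|M x]; first by rewrite !mulr_ge0.
apply: (le_trans (nC _)); rewrite -!mulrA ler_wpM2l//.
apply: (le_trans (normr_mulmx_le _ _)); rewrite -!mulrA ler_wpM2l//.
by rewrite [leRHS]mulrCA ler_wpM2l.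
Qed.

End NormEquivalence.

(** * Bohl exponents and exponential growth of solutions *)

Section BohlExponents.
Context (R : realType) (d : nat) (nrm : 'cV[R]_d -> R) (A : nat -> 'M[R]_d).
Hypotheses (nrm_norm : is_norm nrm) (A_lyapunov : lyapunov_sequence A).

Lemma solution_linear a (x y : 'cV[R]_d) n :
  solution A (a *: x + y) n = a *: solution A x n + solution A y n.
Proof. by elim: n => //= n ->; rewrite mulmxDr scalemxAr. Qed.

Lemma solution_neq0 (x : 'cV[R]_d) n : x != 0 -> solution A x n != 0.
Proof.
case: A_lyapunov => Au _ _ x0; elim: n => //= n; apply: contra_neq => Ax0.
by rewrite -(mulKmx (Au n) (solution A x n)) Ax0 mulmx0.
Qed.

Lemma bounded_fun_normr_le (f : nat -> 'M[R]_d) :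
  bounded_fun f -> exists2 M, 0 <= M & forall n, `|f n| <= M.
Proof.
move=> [M [_ fM]]; exists (`|M| + 1) => [|n]; first by rewrite addr_ge0.
by apply: fM => //; rewrite (le_lt_trans (ler_norm _))// ltrDl.
Qed.

(** The bound on [A] controls growth and the bound on the inverses controls decay; one positive
    constant serves both. *)
Lemma lyapunov_step : exists2 K, 0 < K & forall n x,
  nrm (A n *m x) <= K * nrm x /\ nrm x <= K * nrm (A n *m x).
Proof.
have [Au Ab Aib] := A_lyapunov.
have [C C0 CM] := is_norm_mulmx_le nrm_norm.
have [M M0 AM] := bounded_fun_normr_le Ab.
have [N N0 AN] := bounded_fun_normr_le Aib.
have CMN : 0 < C * M + C * N + 1 by rewrite ltr_wpDl// addr_ge0// mulr_ge0.
exists (C * M + C * N + 1) => // n x; split.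
  apply: (le_trans (CM _ _)); rewrite ler_wpM2r ?is_norm_ge0//.
  have := ler_wpM2l C0 (AM n); have := mulr_ge0 C0 N0; lra.
rewrite -{1}(mulKmx (Au n) x).
apply: (le_trans (CM _ _)); rewrite ler_wpM2r ?is_norm_ge0//.
have := ler_wpM2l C0 (AN n); have := mulr_ge0 C0 M0; lra.
Qed.

(** Each step changes the logarithm of the norm by at most [ln K], and the changes telescope. The
    constant is uniform in [x]. *)
Lemma ln_solution_le : exists C, forall x n m, x != 0 -> (m <= n)%N ->
  `|ln (nrm (solution A x n) / nrm (solution A x m))| <= C * (n - m)%:R.
Proof.
have [K K0 AK] := lyapunov_step; exists (ln K) => x n m x0.
have gt0 k : 0 < nrm (solution A x k).
  by apply: is_norm_gt0 => //; exact: solution_neq0.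
elim: n => [|n IHn].
  by rewrite leqn0 => /eqP ->; rewrite divff ?gt_eqF// ln1 normr0 subnn mulr0.
rewrite leq_eqVlt => /predU1P[<-|].
  by rewrite divff ?gt_eqF// ln1 normr0 subnn mulr0.
rewrite ltnS => mn; have {IHn} := IHn mn.
rewrite subSn// -natr1 mulrDr mulr1 !lnM ?posrE ?invr_gt0// lnV ?posrE//.
have [] := AK n (solution A x n).
rewrite -!(@ler_ln _ (nrm _)) ?posrE ?mulr_gt0//; try exact: (gt0 n.+1).
rewrite !lnM ?posrE//; last exact: (gt0 n.+1).
rewrite !ler_norml => h1 h2 /andP[h3 h4] /=.
by apply/andP; split; lra.
Qed.

(** Every tail infimum is below every tail supremum, since the pair [((N + M).+1, 0)] occurs in both
    tails. *)
Lemma lower_le_upper_bohl x : (lower_bohl nrm A x <= upper_bohl nrm A x)%E.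
Proof.
apply/ereal_supP => _ [N _ <-]; apply/ereal_infP => _ [M _ <-].
pose q := (1 / ((N + M).+1 - 0)%N%:R *
  ln (nrm (solution A x (N + M).+1) / nrm (solution A x 0%N)))%:E.
apply: (@le_trans _ _ q).
  apply: ge_ereal_inf; exists q => //; exists ((N + M).+1, 0%N) => //=.
  by rewrite subn0 ltnS leq_addr.
apply: le_ereal_sup_tmp; exists q => //; exists ((N + M).+1, 0%N) => //=.
by rewrite subn0 ltnS leq_addl.
Qed.

Lemma bohl_bounded : exists C, forall x, x != 0 ->
  ((- C)%:E <= lower_bohl nrm A x)%E /\ (upper_bohl nrm A x <= C%:E)%E.
Proof.
have [C lnC] := ln_solution_le; exists C => x x0.
have qC p : (0 < p.1 - p.2)%N ->
    `|1 / (p.1 - p.2)%N%:R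
       * ln (nrm (solution A x p.1) / nrm (solution A x p.2))| <= C.
  move=> p0; rewrite normrM div1r ger0_norm ?invr_ge0// ler_pdivrMl ?ltr0n//.
  by rewrite [leRHS]mulrC lnC// ltnW// -subn_gt0.
split.
  apply: le_ereal_sup_tmp; eexists; first by exists 0%N.
  by apply/ereal_infP => _ [p p0 <-]; rewrite lee_fin; have := qC p p0;
    rewrite ler_norml => /andP[].
apply: ge_ereal_inf; eexists; first by exists 0%N.
by apply/ereal_supP => _ [p p0 <-]; rewrite lee_fin; have := qC p p0;
  rewrite ler_norml => /andP[].
Qed.

Lemma bohl_resolvent_dichotomy gamma x : bohl_resolvent nrm A gamma -> x != 0 ->
  (upper_bohl nrm A x < gamma%:E)%E \/ (gamma%:E < lower_bohl nrm A x)%E.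
Proof.
move=> rg x0; case: (ltP (upper_bohl nrm A x) gamma%:E) => [|gu]; first by left.
right; rewrite ltNge; apply/negP => lg; apply: rg.
by exists x => //=; rewrite lg gu.
Qed.

(** Pairs starting at time 0 translate bounds on quotients into exponential bounds on the
    solution. *)
Lemma bohl_quotient_expR x n (c : R) : x != 0 -> (0 < n)%N ->
  (1 / (n - 0)%N%:R * ln (nrm (solution A x n) / nrm (solution A x 0%N)) <= c)
    = (nrm (solution A x n) <= nrm x * expR (c * n%:R)).
Proof.
move=> x0 n0; have nx0 : 0 < nrm x by apply: is_norm_gt0.
have nxn0 : 0 < nrm (solution A x n).
  by apply: is_norm_gt0 => //; exact: solution_neq0.
rewrite subn0 div1r ler_pdivrMl ?ltr0n// -(ler_expR (ln _)).
rewrite lnK ?posrE ?divr_gt0//=.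
by rewrite ler_pdivrMr// mulrC [n%:R * c]mulrC.
Qed.

(** The strict inequality leaves room for a rate [r] below [gamma]; the zero solution is covered by
    [c = 0]. *)
Lemma bohl_sublevel_growth gamma x : bohl_sublevel nrm A gamma x ->
  exists c r N, [/\ 0 <= c, r < gamma &
    forall n, (N < n)%N -> nrm (solution A x n) <= c * expR (r * n%:R)].
Proof.
move=> [[x0 /ereal_inf_lt[_ [N _ <-] supN]]|->]; last first.
  exists 0, (gamma - 1), 0%N; split=> // [|n _]; first by rewrite gtrBl.
  rewrite mul0r (_ : solution A 0 n = 0) ?is_norm0//.
  by elim: n => //= n ->; rewrite mulmx0.
have [r rg supr] : exists2 r, r < gamma &
    (ereal_sup (bohl_quotients nrm A x N) <= r%:E)%E.
  case: (ereal_sup _) supN => [r||] //=.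
    by rewrite lte_fin; exists r.
  by exists (gamma - 1); [rewrite gtrBl|rewrite leNye].
exists (nrm x), r, N; split=> [||n Nn]; rewrite ?is_norm_ge0//.
rewrite -bohl_quotient_expR// ?(leq_ltn_trans _ Nn)// -lee_fin.
by move/ereal_supP: supr; apply; exists (n, 0%N) => //=; rewrite subn0.
Qed.

Lemma lower_bohl_growth gamma x : x != 0 -> (gamma%:E < lower_bohl nrm A x)%E ->
  exists N, forall n, (N < n)%N ->
    nrm x * expR (gamma * n%:R) <= nrm (solution A x n).
Proof.
move=> x0 /ereal_sup_gt[_ [N _ <-] infN]; exists N => n Nn.
rewrite leNgt; apply/negP => /ltW; rewrite -bohl_quotient_expR//; last first.
  exact: leq_ltn_trans Nn.
apply/negP; rewrite -ltNge -lte_fin (lt_le_trans infN)//.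
by apply: ge_ereal_inf; eexists; last exact: lexx;
  exists (n, 0%N) => //=; rewrite subn0.
Qed.

(* A nonzero combination outside the sublevel would have lower exponent above
   gamma, hence grow faster than the two solutions it is made of. *)
Lemma bohl_sublevel_linear gamma a x y : bohl_resolvent nrm A gamma ->
  bohl_sublevel nrm A gamma x -> bohl_sublevel nrm A gamma y ->
  bohl_sublevel nrm A gamma (a *: x + y).
Proof.
move=> rg /bohl_sublevel_growth[c [r [N [c0 rgam xN]]]].
move=> /bohl_sublevel_growth[c' [r' [N' [c'0 r'gam yN]]]].
set z := a *: x + y; have [->|z0] := eqVneq z 0; first by right.
left; split=> //.
have [//|/(lower_bohl_growth z0)[N'' zN]] := bohl_resolvent_dichotomy rg z0.
exfalso; have nz0 : 0 < nrm z by apply: is_norm_gt0.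
(* The faster of the two rates still lies below [gamma], so the combination would outgrow its own
   upper bound. *)
pose s := Num.max r r'; have sg : 0 < gamma - s by rewrite subr_gt0 gt_max rgam.
pose D := `|a| * c + c'; have D0 : 0 <= D by rewrite addr_ge0// mulr_ge0.
have key n : (maxn N (maxn N' N'') < n)%N ->
    nrm z * expR ((gamma - s) * n%:R) <= D.
  rewrite !gtn_max => /andP[Nn /andP[N'n N''n]].
  rewrite mulrBl expRB mulrA ler_pdivrMr ?expR_gt0//.
  apply: (le_trans (zN _ N''n)); rewrite solution_linear.
  have [nD nZ _] := nrm_norm; apply: (le_trans (nD _ _)).
  rewrite nZ mulrDl -mulrA lerD//.
    rewrite ler_wpM2l// (le_trans (xN _ Nn))// ler_wpM2l// ler_expR.
    by rewrite ler_wpM2r// le_max lexx.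
  rewrite (le_trans (yN _ N'n))// ler_wpM2l// ler_expR.
  by rewrite ler_wpM2r// le_max lexx orbT.
(* Beyond [t], the inequality [1 + y <= expR y] with [y = (gamma - s) * n] already contradicts
   [key]. *)
pose t := D / nrm z / (gamma - s).
have t0 : 0 <= t by rewrite !divr_ge0// ltW.
pose n := (maxn N (maxn N' N'') + Num.bound t).+1.
have tn : t < n%:R.
  by rewrite (lt_le_trans (archi_boundP t0))// ler_nat /n leqW// leq_addl.
have /key : (maxn N (maxn N' N'') < n)%N by rewrite ltnS leq_addr.
rewrite -ler_pdivlMl// leNgt => /negP; apply.
rewrite mulrC (lt_le_trans _ (expR_ge1Dx _))// ltr_wpDl//.
by rewrite [ltRHS]mulrC -ltr_pdivrMr.
Qed.

End BohlExponents.

(** * Linear sets as subspaces, and ranks of attained values *)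

(** Among the subspaces inside [S] take one of maximal dimension: adjoining the line of a point of
    [S] stays inside [S], so by maximality it adds nothing. *)
Lemma linear_set_vspace (K : fieldType) (vT : vectType K) (S : set vT) :
  S 0 -> (forall a x y, S x -> S y -> S (a *: x + y)) ->
  exists W : {vspace vT}, [set x | x \in W] = S.
Proof.
move=> S0 Slin.
pose P n := `[< exists2 W : {vspace vT}, \dim W = n & forall x, x \in W -> S x >].
have exP : exists n, P n.
  exists 0%N; apply/asboolP; exists 0%VS; first exact: dimv0.
  by move=> x; rewrite memv0 => /eqP ->.
have ubP n : P n -> (n <= \dim {:vT})%N.
  by move=> /asboolP[W <- _]; rewrite dimvS// subvf.
case: (ex_maxnP exP ubP) => _ /asboolP[W <- WS] Wmax; exists W.
apply/seteqP; split=> x /=; first exact: WS.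
move=> Sx; rewrite memvE.
have : (W + <[x]> <= W)%VS.
  have WWx : (W <= W + <[x]>)%VS by exact: addvSl.
  rewrite -(geq_leqif (dimv_leqif_sup WWx)).
  apply: Wmax; apply/asboolP; exists (W + <[x]>)%VS => // u /memv_addP.
  move=> [w /WS Sw [y /vlineP[a ->] ->]]; rewrite addrC; exact: Slin.
exact/subv_trans/addvSr.
Qed.

(** [g t] is the position of [f t] in the increasing list of attained values; at most [d + 1] of
    these occur, and positions start at 0, so [l <= d]. *)
Lemma nat_value_rank (T : Type) (P : set T) (f : T -> nat) (d : nat) :
  P !=set0 -> (forall t, P t -> (f t <= d)%N) ->
  exists (l : nat) (g : T -> nat),
    [/\ (l <= d)%N, forall t, P t -> (g t <= l)%N,
        forall i, (i <= l)%N -> exists2 t, P t & g t = i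
      & forall s t, P s -> P t -> (g s < g t)%N = (f s < f t)%N].
Proof.
move=> [t0 Pt0] fd.
pose ks := [seq k <- iota 0 d.+1 | `[< exists2 t, P t & f t = k >]].
have ksP k : reflect (exists2 t, P t & f t = k) (k \in ks).
  rewrite mem_filter mem_iota add0n /= ltnS; apply: (iffP andP).
    by move=> [/asboolP].
  by move=> Pk; split; [exact/asboolP|case: Pk => t Pt <-; exact: fd].
have fks t : P t -> f t \in ks by move=> Pt; apply/ksP; exists t.
have ks_sorted : sorted ltn ks.
  by apply: sorted_filter; [exact: ltn_trans|exact: iota_ltn_sorted].
have ks_uniq : uniq ks by exact: (sorted_uniq ltn_trans ltnn).
have ks_size : (0 < size ks)%N by case: (ks) (fks _ Pt0).
exists (size ks).-1, (fun t => index (f t) ks); split.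
- rewrite -ltnS prednK//.
  by rewrite (leq_trans (size_subseq (filter_subseq _ _)))// size_iota.
- by move=> t Pt; rewrite -ltnS prednK// index_mem fks.
- move=> i; rewrite -ltnS prednK// => il.
  have /ksP[t Pt ft] := mem_nth 0%N il.
  by exists t => //; rewrite ft index_uniq.
- move=> s t Ps Pt.
  have := @lt_sorted_ltn_nth _ nat 0%N ks ks_sorted
    (index (f s) ks) (index (f t) ks).
  by rewrite !inE !index_mem !fks// !nth_index ?fks// => /(_ isT isT) /esym.
Qed.

(** * Intervals cut out of [sigma] by a rank function on its complement *)

(* In the application g t is the rank of the dimension of the sublevel at t
   among the dimensions that occur at resolvent points. *)
Section SpectralIntervals.
Context (R : realType) (sigma : set R) (C : R) (l : nat) (g : R -> nat).
Hypotheses (sigmaC : forall r, sigma r -> - C <= r <= C)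
  (g_le : forall t, ~ sigma t -> (g t <= l)%N)
  (g_onto : forall i, (i <= l)%N -> exists2 t, ~ sigma t & g t = i)
  (g_jump : forall s t, ~ sigma s -> ~ sigma t -> s <= t ->
     (g s <= g t)%N /\ ((g s < g t)%N <-> exists2 r, sigma r & s < r < t)).

(** Interval [i] is the part of [sigma] where the rank passes from [i - 1] to [i]. The bounds on [i]
    make the sets of index [0] and [l.+1] empty, as the conventions on the end intervals require. *)
Definition spectral_interval (i : nat) : set R :=
  [set r | [/\ (1 <= i <= l)%N, sigma r &
     forall t, ~ sigma t -> ((g t < i)%N -> t < r) /\ ((i <= g t)%N -> r < t)]].

Lemma sigma_ltVgt r t : sigma r -> ~ sigma t -> t < r \/ r < t.
Proof. by move=> sr st; case: (ltgtP t r) => [| |tr]; [left|right|subst]. Qed.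

(** Between points of ranks [i.-1] and [i] the jump yields some [r] in [sigma]. A point [u] on the
    wrong side of [r] would be separated by [r] from one of them, forcing a rank jump that
    contradicts [g u]. *)
Lemma spectral_interval_nonempty i :
  (1 <= i <= l)%N -> spectral_interval i !=set0.
Proof.
move=> /andP[i1 il].
have [s ss gs] := g_onto (leq_trans (leq_pred i) il).
have [t st gt] := g_onto il.
have gst : (g s < g t)%N by rewrite gs gt prednK.
have lt_st : s < t.
  by rewrite ltNge; apply/negP => /(g_jump st ss)[]; rewrite leqNgt gst.
have [_ [/(_ gst)[r sr /andP[lt_sr rt]] _]] := g_jump ss st (ltW lt_st).
exists r; split=> //; first by rewrite i1.
move=> u su; split=> gu; have [ur|ru]// := sigma_ltVgt sr su; exfalso.
  have [_ [_ ]] := g_jump ss su (ltW (lt_trans lt_sr ru)).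
  have jmp : exists2 r, sigma r & s < r < u by exists r => //; rewrite lt_sr.
  by move/(_ jmp); rewrite gs ltnNge -ltnS prednK// gu.
have [_ [_ ]] := g_jump su st (ltW (lt_trans ur rt)).
have jmp : exists2 r, sigma r & u < r < t by exists r => //; rewrite ur.
by move/(_ jmp); rewrite gt ltnNge gu.
Qed.

(** A point of the complement between [x] and [y] would, according to its rank, lie strictly below
    [x] or strictly above [y]. *)
Lemma spectral_interval_is_interval i : is_interval (spectral_interval i).
Proof.
move=> x y [il sx xP] [_ sy yP] z /andP[xz zy]; split=> //.
  apply: contrapT => sz; case: (ltnP (g z) i) => gz.
    by have [/(_ gz)] := xP z sz; rewrite ltNge xz.
  by have [_ /(_ gz)] := yP z sz; rewrite ltNge zy.
move=> t st; have [xt _] := xP t st; have [_ yt] := yP t st; split=> gt.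
  exact: lt_le_trans (xt gt) xz.
exact: le_lt_trans zy (yt gt).
Qed.

Lemma spectral_interval_bounded i : bounded_set (spectral_interval i).
Proof.
exists C; split=> [|M CM r [_ /sigmaC rC _] /=]; first exact: num_real.
by rewrite (le_trans _ (ltW CM))// ler_norml.
Qed.

(** A complement point of rank [i] separates interval [i] from all intervals of larger index. *)
Lemma spectral_interval_trivIset D : trivIset D spectral_interval.
Proof.
have disj i j r : spectral_interval i r -> spectral_interval j r -> (j <= i)%N.
  move=> [/andP[_ il] sr iP] [_ _ jP]; rewrite leqNgt; apply/negP => ij.
  have [t st gt] := g_onto il.
  have [_ /(_ _)] := iP t st; rewrite gt => /(_ (leqnn _)) rt.
  by have [/(_ _)] := jP t st; rewrite gt => /(_ ij); rewrite ltNge ltW.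
move=> i j _ _ [r [ir jr]].
by apply/eqP; rewrite eqn_leq (disj _ _ _ ir jr) (disj _ _ _ jr ir).
Qed.

Lemma spectral_intervalE :
  sigma = \bigcup_(i in [set i | (1 <= i <= l)%N]) spectral_interval i.
Proof.
apply/seteqP; split=> r /=; last by move=> [i _ []].
move=> sr; have /andP[Cr rC] := sigmaC sr.
have sC : ~ sigma (C + 1).
  by move=> /sigmaC /andP[_]; rewrite gerDl ler10.
have sNC : ~ sigma (- C - 1).
  by move=> /sigmaC /andP[+ _]; rewrite lerBrDl gerDr ler10.
(* The index of the interval containing [r] is the least rank found above [r]; [C + 1] shows that
   such ranks exist, and [- C - 1], lying below [r], shows that the index is positive. *)
pose P i := `[< exists t, [/\ ~ sigma t, r < t & g t = i] >].
have exP : exists i, P i.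
  exists (g (C + 1)); apply/asboolP; exists (C + 1).
  by rewrite (le_lt_trans rC) ?ltrDl.
case: (ex_minnP exP) => _ /asboolP[t [st rt <-]] gt_min.
have rNC : - C - 1 < r by rewrite (lt_le_trans _ Cr)// gtrBl.
have below u : ~ sigma u -> u < r -> (g u < g t)%N.
  move=> su ur; apply/(g_jump su st _).2; first exact: ltW (lt_trans ur rt).
  by exists r => //; rewrite ur.
have it : (1 <= g t <= l)%N.
  by rewrite (leq_ltn_trans _ (below _ sNC rNC))//= g_le.
exists (g t) => //; split=> // u su; have [ur|ru] := sigma_ltVgt sr su; split=> //.
  by rewrite leqNgt below.
rewrite ltnNge gt_min//; apply/asboolP; by exists u.
Qed.

Lemma gap_spectral_interval i t : ~ sigma t -> g t = i ->
  gap (spectral_interval i) (spectral_interval i.+1) t.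
Proof.
move=> st gt; apply/andP; split.
  apply/ereal_supP => _ [r [_ _ /(_ t st)[_ rP]] <-].
  by rewrite lee_fin ltW// rP// gt.
apply/ereal_infP => _ [r [_ _ /(_ t st)[rP _]] <-].
by rewrite lee_fin ltW// rP// gt.
Qed.

(** A rank below [i] would put [t] strictly below the points of interval [i], a rank above [i]
    strictly above those of interval [i.+1]; the relevant interval is nonempty. *)
Lemma gap_spectral_interval_rank i t : (i <= l)%N -> ~ sigma t ->
  gap (spectral_interval i) (spectral_interval i.+1) t -> g t = i.
Proof.
move=> il st /andP[/ereal_supP supt /ereal_infP inft].
have [gi|gi|//] := ltngtP (g t) i.
  have /spectral_interval_nonempty[r rI] : (1 <= i <= l)%N.
    by rewrite il (leq_ltn_trans _ gi).
  have := supt r%:E (ex_intro2 _ _ r rI erefl); rewrite lee_fin leNgt.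
  by case: rI => _ _ /(_ t st)[-> ].
have /spectral_interval_nonempty[r rI] : (1 <= i.+1 <= l)%N.
  by rewrite (leq_trans gi)// g_le.
have := inft r%:E (ex_intro2 _ _ r rI erefl); rewrite lee_fin leNgt.
by case: rI => _ _ /(_ t st)[_ ->].
Qed.

End SpectralIntervals.

(** * Spectral intervals and filtration of the system *)

Theorem theorem13 (R : realType) (d : nat) (nrm : 'cV[R]_d -> R)
    (A : nat -> 'M[R]_d) (d_gt0 : (0 < d)%N) (nrm_norm : is_norm nrm)
    (A_lyapunov : lyapunov_sequence A) :
  exists (l : nat) (I : nat -> set R),
    [/\ (1 <= l <= d)%N /\
        bohl_spectrum nrm A
          = \bigcup_(i in [set i | (1 <= i <= l)%N]) (EFin @` I i),
        (forall i, (1 <= i <= l)%N ->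
           [/\ I i !=set0, is_interval (I i) & bounded_set (I i)]),
        trivIset [set i | (1 <= i <= l)%N] I,
        (forall i, (1 <= i < l)%N ->
           (ereal_sup (EFin @` I i) <= ereal_inf (EFin @` I i.+1))%E /\
           gap (I i) (I i.+1) `&` bohl_resolvent nrm A !=set0)
      & I 0%N = set0 /\ I l.+1 = set0]
    /\
    (exists V : nat -> {vspace 'cV[R]_d},
       [/\ V 0%N = 0%VS,
           V l = fullv,
           (forall i, (i < l)%N -> (V i <= V i.+1)%VS /\ V i != V i.+1)
         & forall i gamma, (i <= l)%N ->
             (gap (I i) (I i.+1) `&` bohl_resolvent nrm A) gamma ->
             [set x | x \in V i] = bohl_sublevel nrm A gamma])
    /\
    (forall i gamma gamma', (i <= l)%N ->
       (gap (I i) (I i.+1) `&` bohl_resolvent nrm A) gamma ->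
       (gap (I i) (I i.+1) `&` bohl_resolvent nrm A) gamma' ->
       bohl_sublevel nrm A gamma = bohl_sublevel nrm A gamma').
Proof.
pose rho := bohl_resolvent nrm A; pose sub := bohl_sublevel nrm A.
pose sigma : set R := ~` rho.
have sigmaE r : sigma r = bohl_spectrum nrm A r%:E by exact: notK.
have rhoE r : (~ sigma r) = rho r by exact: notK.
have [C bohlC] := bohl_bounded nrm_norm A_lyapunov.
have sigmaC r : sigma r -> - C <= r <= C.
  rewrite sigmaE => -[x x0 /= /andP[lr ru]]; have [lC uC] := bohlC x x0.
  by rewrite -!lee_fin (le_trans lC lr) (le_trans ru uC).
have dich t x := @bohl_resolvent_dichotomy _ _ nrm A t x.
(* [V t] is the sublevel as a subspace; outside the resolvent the zero space is a dummy value. *)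
have /choice[V VP] t : exists W : {vspace 'cV[R]_d},
    rho t -> [set x | x \in W] = sub t.
  have [rt|nrt] := pselect (rho t); last by exists 0%VS.
  have [|a x y Sx Sy|W WE] := @linear_set_vspace _ _ (sub t); first by right.
    exact: bohl_sublevel_linear.
  by exists W.
have VE t x : rho t -> (x \in V t) = `[< sub t x >].
  by move=> rt; rewrite -VP//; apply/idP/asboolP.
have sub_le s t : rho s -> rho t -> s <= t -> (V s <= V t)%VS.
  move=> rs rt st; apply/subvP => x; rewrite !VE// => /asboolP sx.
  apply/asboolP; case: sx => [[x0 us]|->]; [left|by right].
  by split=> //; rewrite (lt_le_trans us)// lee_fin.
(* If [x] lies in [V t] but not in [V s], its upper exponent is the separating spectral point.
   Conversely, a vector whose Bohl interval contains [r] lies in [V t] by the dichotomy at [t], and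
   not in [V s]. *)
have jump s t : ~ sigma s -> ~ sigma t -> s <= t ->
    (\dim (V s) <= \dim (V t))%N /\
    ((\dim (V s) < \dim (V t))%N <-> exists2 r, sigma r & s < r < t).
  rewrite !rhoE => rs rt st; have Vst := sub_le s t rs rt st.
  split; first exact: dimvS.
  rewrite (ltn_leqif (dimv_leqif_sup Vst)); split=> [/subvPn[x]|[r]].
    rewrite !VE// => /asboolP xt /asboolP xs.
    have x0 : x != 0 by apply/eqP => x0; apply: xs; right.
    case: xt => [[_ ut]|//]; last by move=> x00; rewrite x00 eqxx in x0.
    have [us|sl] := dich s x rs x0; first by case: xs; left.
    have lu := lower_le_upper_bohl nrm A x.
    have [lC uC] := bohlC x x0.
    have ufin : upper_bohl nrm A x \is a fin_num.
      rewrite fin_numE; apply/andP; split.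
        by rewrite -ltNye (lt_le_trans _ (le_trans lC lu))// ltNyr.
      by rewrite -ltey (le_lt_trans uC)// ltry.
    exists (fine (upper_bohl nrm A x)).
      by rewrite sigmaE fineK//; exists x => //=; rewrite lu lexx.
    by rewrite -!lte_fin fineK// ut (lt_le_trans sl).
  rewrite sigmaE => -[x x0 /= /andP[lr ru]] /andP[sr rt'].
  apply/subvPn; exists x; rewrite VE//; apply/asboolP.
    have [ut|tl] := dich t x rt x0; first by left.
    by have := lt_le_trans tl lr; rewrite lte_fin ltNge ltW.
  move=> [[_ us]|/eqP]; last by rewrite (negbTE x0).
  by have := le_lt_trans ru us; rewrite lte_fin ltNge ltW.
have low t : t < - C -> rho t /\ V t = 0%VS.
  move=> tC; have rt : rho t.
    by rewrite -rhoE => /sigmaC; rewrite leNgt tC.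
  split=> //; apply/eqP; rewrite -subv0; apply/subvP => x.
  rewrite VE// memv0 => /asboolP[[x0 ut]|->//].
  have [lC _] := bohlC x x0.
  have := le_lt_trans lC (le_lt_trans (lower_le_upper_bohl nrm A x) ut).
  by rewrite lte_fin ltNge ltW.
have high t : C < t -> rho t /\ V t = fullv.
  move=> Ct; have rt : rho t.
    by rewrite -rhoE => /sigmaC /andP[_]; rewrite leNgt Ct.
  split=> //; apply/vspaceP => x; rewrite memvf VE//; apply/asboolP.
  have [->|x0] := eqVneq x 0; first by right.
  by left; split=> //; have [_ uC] := bohlC x x0; rewrite (le_lt_trans uC).
have dimd : \dim {: 'cV[R]_d} = d by rewrite dimvf /dim /= muln1.
have NC1 : - C - 1 < - C by rewrite gtrBl.
have C1 : C < C + 1 by rewrite ltrDl.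
have [|t _|l [g [ld gl g_onto g_lt]]] :=
    @nat_value_rank _ rho (fun t => \dim (V t)) d.
- by exists (C + 1); apply: (high _ _).1.
- by rewrite -[leqRHS]dimd dimvS// subvf.
have g_jump s t : ~ sigma s -> ~ sigma t -> s <= t ->
    (g s <= g t)%N /\ ((g s < g t)%N <-> exists2 r, sigma r & s < r < t).
  move=> ss tt st; have [] := jump s t ss tt st.
  by rewrite leqNgt -!g_lt -?rhoE// -leqNgt.
have {}gl t : ~ sigma t -> (g t <= l)%N by rewrite rhoE; exact: gl.
have {}g_onto i : (i <= l)%N -> exists2 t, ~ sigma t & g t = i.
  by move=> /g_onto[t rt gt]; exists t; rewrite ?rhoE.
(* The sublevels are nested, so equal rank, hence equal dimension, forces equality. *)
have Veq s t : rho s -> rho t -> g s = g t -> V s = V t.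
  wlog st : s t / s <= t.
    move=> H rs rt gst; have [st|/ltW ts] := leP s t; first exact: H.
    by apply/esym; apply: H.
  move=> rs rt gst; apply/eqP; rewrite (eqEdim) sub_le//=.
  by rewrite leqNgt -g_lt// gst ltnn.
have gap_g i t := @gap_spectral_interval_rank R sigma l g gl g_onto g_jump i t.
have g_gap i t := @gap_spectral_interval R sigma l g i t.
set I := spectral_interval sigma l g in gap_g g_gap.
(* [tt i] is a resolvent point of rank [i]; beyond [l] the value 0 is a dummy. *)
have /choice[tt tt_rho] i : exists t, (i <= l)%N -> ~ sigma t /\ g t = i.
  have [/g_onto[t st gt]|_] := leqP i l; last by exists 0.
  by exists t.
have l_gt0 : (0 < l)%N.
  have [r0 V0] := low _ NC1; have [r1 V1] := high _ C1.
  have : (g (- C - 1)%R < g (C + 1)%R)%N by rewrite g_lt// V0 V1 dimv0 dimd.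
  by move/(leq_ltn_trans (leq0n _))/leq_trans; apply; rewrite gl ?rhoE.
exists l, I; split; last split.
- split.
  + split; first by rewrite l_gt0.
    apply/seteqP; split=> [e [x x0 /= leu]|_ [i _ [r [_ sr _] <-]]]; last first.
      by rewrite -sigmaE.
    (* The uniform bounds on the exponents exclude infinite points. *)
    have [r er] : exists r, e = r%:E.
      case/andP: leu => le eu; have [lC uC] := bohlC x x0.
      case: e le eu => [r||] le eu; first by exists r.
        by have := le_trans eu uC.
      by have := le_trans lC le.
    have : sigma r by rewrite sigmaE -er; exists x.
    rewrite (spectral_intervalE sigmaC gl g_jump) => -[i il iI].
    by exists i => //; exists r.
  + move=> i il; split; first exact: spectral_interval_nonempty.
      exact: spectral_interval_is_interval.
    exact: (@spectral_interval_bounded R sigma C l g sigmaC i).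
  + exact: spectral_interval_trivIset.
  + move=> i /andP[_ il]; have [st gt] := tt_rho i (ltnW il).
    have gapt := g_gap _ _ st gt; rewrite rhoE in st.
    split; last by exists (tt i).
    by case/andP: gapt; exact: le_trans.
  + by split; apply/seteqP; split=> r // -[]; rewrite ?ltnn ?andbF.
- exists (fun i => V (tt i)); split.
  (* Below [- C] the sublevel has dimension 0, so no rank is smaller there: its rank is 0. *)
  + have [r0 V0] := low _ NC1; rewrite -V0; have [] := tt_rho 0%N isT.
    rewrite rhoE => rt gt; apply: Veq => //; rewrite gt; apply/eqP.
    by rewrite eq_sym eqn0Ngt -gt g_lt// V0 dimv0 ltn0.
  + have [r1 V1] := high _ C1; rewrite -V1; have [] := tt_rho l (leqnn l).
    rewrite rhoE => rt gt; apply: Veq => //; rewrite gt; apply/eqP.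
    rewrite eqn_leq gl ?rhoE// andbT leqNgt -{1}gt g_lt// V1 -leqNgt.
    by rewrite dimvS// subvf.
  + move=> i il; have [] := tt_rho i (ltnW il); have [] := tt_rho i.+1 il.
    rewrite !rhoE => rt gt rs gs.
    have dlt : (\dim (V (tt i)) < \dim (V (tt i.+1)))%N by rewrite -g_lt// gs gt.
    split; last by apply: contraTneq dlt => ->; rewrite ltnn.
    (* The reverse order of the two points would reverse the inclusion and contradict [dlt]. *)
    apply: (sub_le _ _ rs rt); rewrite leNgt; apply/negP => /ltW /(sub_le _ _ rt rs).
    by move=> /dimvS; rewrite leqNgt dlt.
  + move=> i t il [gapt rt]; have [] := tt_rho i il; rewrite rhoE => rs gs.
    by rewrite (Veq (tt i) t) ?VP// gs; apply/esym/gap_g => //.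
- move=> i s t il [gs rs] [gt rt].
  rewrite -[LHS]VP// -[RHS]VP// (Veq s t)//.
  by rewrite (gap_g i s) ?(gap_g i t) ?rhoE.
Qed.
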